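(* Let $\varphi:\Omega_1\to\mathring\Omega_0$ be the map defined on aromatic trees by attaching a self-loop to the root, extended by linearity. Define any total order on $\mathcal T$. Then a basis of $\Psi=\operatorname{Ker}(d_H|_{\Omega_1})$ is $$\mathcal B_\Psi=\big\{d_H\big(\phi\,\varphi(t_2)\cdots\varphi(t_{l-1})\varphi(t_{l+1})\cdots\varphi(t_k)\;t_1\wedge t_l\big)\ :\ \phi\in\mathcal F_0\cup\{\emptyset\},\ t_1<\dots<t_k\in\mathcal T\big\},$$ where $k\ge2$ and $2\le l\le k$.
   Context: Aromatic forests (without covertices). Let $V$ be a finite nonempty set of nodes and $E\subset V\times V$ a set of edges; an edge $(v,w)$ goes from $v$ to $w$. Each node is the source of at most one edge; nodes with no outgoing edge are called roots and are numbered $1,\dots,n$; other nodes are unnumbered. Such graphs, up to isomorphism preserving the numbering of roots, are aromatic forests; $\mathcal F_n$ is the set of aromatic forests with $n$ roots, and the elements of $\mathcal F_1$ are called aromatic trees. $\emptyset$ denotes the empty scalar. Juxtaposition denotes disjoint union of graphs (aromas, i.e. connected components without root, are unordered factors). $\mathcal T\subset\mathcal F_1$ is the set of connected elements of $\mathcal F_1$ (rooted trees without aromas). Forms. $\Omega_n=\wedge\operatorname{Span}_{\mathbb R}(\mathcal F_n)$ where $\wedge\gamma=\frac1{n!}\sum_{\sigma\in S_n}\varepsilon(\sigma)\sigma\gamma$, with $S_n$ permuting the numbers of the roots and $\varepsilon$ the signature; thus $\Omega_0=\operatorname{Span}\mathcal F_0$, $\Omega_1=\operatorname{Span}\mathcal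 F_1$. For $\psi$ a scalar (an element of $\mathcal F_0\cup\{\emptyset\}$) and $t,t'\in\mathcal T$, $\psi\,t\wedge t'=\frac12(\psi\,t\,t'-\psi\,t'\,t)\in\Omega_2$, where in $\psi\,t\,t'$ the root of $t$ is number 1 and the root of $t'$ number 2. For $\gamma\in\mathcal F_n$, $n\ge1$, with last root $r_n$, $d_H\gamma$ is the sum over all nodes $u$ (including $u=r_n$) of $\gamma$ with the edge $(r_n,u)$ added; linearly $d_H:\Omega_n\to\Omega_{n-1}$. A 1-loop (self-loop) is an edge $(v,v)$; $\mathring\Omega_0\subset\Omega_0$ is the span of forests in $\mathcal F_0$ having at least one 1-loop.
   Formalization: With φ free in F_0∪{∅} the set is linearly dependent (expand d_H d_H(t_1∧t_2∧t_3)=0); the formal set requires in addition that every tree s∈T whose looped version φ(s) is an aroma of the scalar factor φ be one of t_1,…,t_k. *)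

(* Defs.v *)
(* Isomorphism classes are quotients by generic_quotient, and free vector spaces
   are the {malg R[K]} of multinomials. *)
From mathcomp Require Import all_boot all_order all_algebra.
From mathcomp Require Import generic_quotient finmap.
From mathcomp Require Import reals.
From mathcomp.multinomials Require Import monalg.

Set Implicit Arguments.
Unset Strict Implicit.
Unset Printing Implicit Defensive.

Import GRing.Theory.
Local Open Scope ring_scope.
Local Open Scope quotient_scope.

(* A graph on the nodes 'I_m in which each node is the source of at most one
   edge is given by its successor function s: s v = inl w when (v, w) is an
   edge, s v = inr i when v is a root and has number i (counted from 0). *)
Definition pregraph (n : nat) := {m : nat & {ffun 'I_m -> 'I_m + 'I_n}}.

Definition valid (n : nat) (g : pregraph n) : bool :=
  (0 < tag g)%N && [forall i : 'I_n, #|[pred v | tagged g v == inr i]| == 1%N].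

Definition graph (n : nat) := {g : pregraph n | valid g}.

Definition nodes (n : nat) (g : graph n) : finType := 'I_(tag (val g)).

Definition succ (n : nat) (g : graph n) : nodes g -> nodes g + 'I_n :=
  tagged (val g).

Definition map_node (A B C : Type) (p : A -> B) (x : A + C) : B + C :=
  match x with inl a => inl (p a) | inr i => inr i end.

Definition iso (n : nat) (g h : graph n) : bool :=
  [exists p : {ffun nodes g -> nodes h},
    [&& injectiveb p, [forall w, w \in codom p]
      & [forall v, succ (p v) == map_node p (succ v)]]].

Lemma isoP (n : nat) (g h : graph n) :
  reflect (exists2 p : nodes g -> nodes h, bijective p &
             forall v, succ (p v) = map_node p (succ v))
          (iso g h).
Proof.
apply: (iffP existsP) => [[p /and3P[/injectiveP pI /forallP pS /forallP pE]]|].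
  exists p => [|v]; last exact/eqP.
  exists (fun w => iinv (pS w)) => [v|w]; last exact: f_iinv.
  by apply: pI; rewrite f_iinv.
case=> p bp pE; exists [ffun v => p v]; apply/and3P; split.
- by apply/injectiveP => x y; rewrite !ffunE; exact: bij_inj.
- apply/forallP => w; case: bp => q _ qK.
  by apply/codomP; exists (q w); rewrite ffunE qK.
- by apply/forallP => v; rewrite ffunE pE; case: (succ v) => //= a; rewrite ffunE.
Qed.

Lemma iso_refl (n : nat) : reflexive (@iso n).
Proof.
move=> g; apply/isoP; exists id; first by exists id.
by move=> v; case: (succ v).
Qed.

Lemma iso_sym (n : nat) : symmetric (@iso n).
Proof.
suff sub (g h : graph n) : iso g h -> iso h g.
  by move=> g h; apply/idP/idP; exact: sub.
case/isoP => p [q pK qK] pE; apply/isoP; exists q; first by exists p.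
move=> w; rewrite -{2}(qK w) pE.
by case: (succ (q w)) => //= a; rewrite pK.
Qed.

Lemma iso_trans (n : nat) : transitive (@iso n).
Proof.
move=> h g k /isoP[p bp pE] /isoP[q bq qE]; apply/isoP.
exists (q \o p); first exact: bij_comp.
by move=> v /=; rewrite qE pE; case: (succ v).
Qed.

Definition iso_equiv (n : nat) : equiv_rel (graph n) :=
  EquivRel (@iso n) (@iso_refl n) (@iso_sym n) (@iso_trans n).

(* the set F_n of aromatic forests with n roots *)
Definition forest (n : nat) := {eq_quot (iso_equiv n)}.

(* [link tgt g] adds an edge from the last root r of g to tgt r, so that r is
   not a root any more. *)
Definition prelink (n : nat) (g : graph n.+1) (tgt : nodes g -> nodes g) :
    pregraph n :=
  Tagged (fun m => {ffun 'I_m -> 'I_m + 'I_n})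
    [ffun v : nodes g =>
       match succ v with
       | inl w => inl w
       | inr i => if unlift ord_max i is Some j then inr j else inl (tgt v)
       end].

Lemma valid_link (n : nat) (g : graph n.+1) (tgt : nodes g -> nodes g) :
  valid (prelink tgt).
Proof.
case/andP: (valP g) => m_gt0 /forallP gP; apply/andP; split=> //.
apply/forallP => j; rewrite -(eqP (gP (lift ord_max j))); apply/eqP.
apply: eq_card => v; rewrite !inE /= ffunE /succ.
case: (tagged (val g) v) => [//|i].
case: unliftP => [k ->|->].
  by rewrite !(inj_eq inr_inj) (inj_eq lift_inj).
by rewrite (inj_eq inr_inj) (negbTE (neq_lift _ _)).
Qed.

Definition link (n : nat) (g : graph n.+1) (tgt : nodes g -> nodes g) :
  graph n := exist _ (prelink tgt) (valid_link tgt).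

(* disjoint union; the roots of the second graph are numbered after those of
   the first one *)
Definition preunion (p q : nat) (g : graph p) (h : graph q) : pregraph (p + q) :=
  Tagged (fun m => {ffun 'I_m -> 'I_m + 'I_(p + q)})
    [ffun v : 'I_(tag (val g) + tag (val h)) =>
       match split v with
       | inl a => match tagged (val g) a with
                  | inl w => inl (lshift _ w) | inr i => inr (lshift q i) end
       | inr b => match tagged (val h) b with
                  | inl w => inl (rshift _ w) | inr i => inr (rshift p i) end
       end].

Lemma valid_union (p q : nat) (g : graph p) (h : graph q) :
  valid (preunion g h).
Proof.
case/andP: (valP g) => m_gt0 /forallP gP.
case/andP: (valP h) => m'_gt0 /forallP hP.
apply/andP; split; first by rewrite /= addn_gt0 m_gt0.
apply/forallP => i; apply/eqP; rewrite -sum1_card big_split_ord /=.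
under eq_bigl => a do rewrite inE /= ffunE (unsplitK (inl a)).
under [X in (_ + X)%N]eq_bigl => b do rewrite inE /= ffunE (unsplitK (inr b)).
case: (splitP i) => j ij.
  have -> : i = lshift q j by exact: val_inj.
  rewrite [X in (_ + X)%N]big_pred0 => [|b]; last first.
    by case: (tagged (val h) b) => // k; rewrite (inj_eq inr_inj) eq_rlshift.
  rewrite addn0 -[RHS](eqP (gP j)) -sum1_card; apply: eq_bigl => a; rewrite inE.
  by case: (tagged (val g) a) => // k; rewrite !(inj_eq inr_inj) (inj_eq (@lshift_inj _ _)).
have -> : i = rshift p j by exact: val_inj.
rewrite big_pred0 => [|b]; last first.
  by case: (tagged (val g) b) => // k; rewrite (inj_eq inr_inj) eq_lrshift.
rewrite add0n -[RHS](eqP (hP j)) -sum1_card; apply: eq_bigl => a; rewrite inE.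
by case: (tagged (val h) a) => // k; rewrite !(inj_eq inr_inj) (inj_eq (@rshift_inj _ _)).
Qed.

Definition union (p q : nat) (g : graph p) (h : graph q) : graph (p + q) :=
  exist _ (preunion g h) (valid_union g h).

Definition connected (n : nat) (g : graph n) : bool :=
  let adj u v := (succ u == inl v) || (succ v == inl u) in
  [forall u : nodes g, forall v : nodes g, connect adj u v].

(* The operations on isomorphism classes are computed on representatives; the
   lemmas jux_pi, attach_loop_pi, is_connected_pi and dH_forest_pi show that the
   choice of the representatives is irrelevant. *)

Definition jux (p q : nat) (x : forest p) (y : forest q) : forest (p + q) :=
  \pi_(forest (p + q)) (union (repr x) (repr y)).

(* the map varphi on aromatic trees: a self-loop is attached to the root *)
Definition attach_loop (x : forest 1) : forest 0 :=
  \pi_(forest 0) (link (g := repr x) id).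

Definition is_connected (n : nat) (x : forest n) : bool := connected (repr x).

Lemma forest_eqP (n : nat) (g h : graph n) :
  reflect (\pi_(forest n) g = \pi_(forest n) h) (iso g h).
Proof. exact: (iffP (eqmodP (iso_equiv n) g h)). Qed.

Lemma iso_repr (n : nat) (g : graph n) : iso (repr (\pi_(forest n) g)) g.
Proof. by apply/forest_eqP; rewrite reprK. Qed.

Lemma iso_link (n : nat) (g h : graph n.+1) (p : nodes g -> nodes h)
    (tg : nodes g -> nodes g) (th : nodes h -> nodes h) :
    bijective p -> (forall v, succ (p v) = map_node p (succ v)) ->
    (forall v, p (tg v) = th (p v)) ->
  iso (link tg) (link th).
Proof.
move=> bp pE tE; apply/isoP; exists p => // v.
rewrite /succ /= ffunE -/(succ (p v)) ffunE pE.
case: (@succ _ g v) => [w|i] /=; first by [].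
by case: (unlift ord_max i) => //=; rewrite tE.
Qed.

Lemma iso_union (p q : nat) (g g' : graph p) (h h' : graph q) :
  iso g g' -> iso h h' -> iso (union g h) (union g' h').
Proof.
case/isoP => a [a' aK a'K] aE /isoP[b [b' bK b'K] bE]; apply/isoP.
exists (fun v => unsplit (match split v with
                          inl x => inl (a x) | inr y => inr (b y) end)).
  exists (fun v => unsplit (match split v with
                            inl x => inl (a' x) | inr y => inr (b' y) end)).
    move=> v; rewrite unsplitK -[RHS]splitK; congr unsplit.
    by case: (split v) => x; rewrite ?aK ?bK.
  move=> v; rewrite unsplitK -[RHS]splitK; congr unsplit.
  by case: (split v) => x; rewrite ?a'K ?b'K.
move=> v; rewrite /succ /= !ffunE unsplitK.
case: (split v) => x.
  have := aE x; rewrite /succ => ->.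
  by case: (tagged (val g) x) => //= w; rewrite (unsplitK (inl w)).
have := bE x; rewrite /succ => ->.
by case: (tagged (val h) x) => //= w; rewrite (unsplitK (inr w)).
Qed.

Lemma iso_connected (n : nat) (g h : graph n) :
  iso g h -> connected g = connected h.
Proof.
suff sub (g' h' : graph n) : iso g' h' -> connected g' -> connected h'.
  by move=> gh; apply/idP/idP; apply: sub; rewrite // iso_sym.
case/isoP => p [q pK qK] pE /forallP gC.
apply/forallP => x; apply/forallP => y.
have /forallP/(_ (q y))/connectP[s sP yE] := gC (q x).
rewrite -(qK x) -(qK y) yE; apply/connectP; exists (map p s); last first.
  by rewrite last_map.
rewrite path_map; apply: sub_path sP => u v /= /orP[] /eqP E.
  by rewrite pE E /= eqxx.
by rewrite [X in _ || (X == _)]pE E /= eqxx orbT.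
Qed.

Lemma jux_pi (p q : nat) (g : graph p) (h : graph q) :
  jux (\pi_(forest p) g) (\pi_(forest q) h) = \pi_(forest (p + q)) (union g h).
Proof. by apply/forest_eqP; apply: iso_union; exact: iso_repr. Qed.

Lemma attach_loop_pi (g : graph 1) :
  attach_loop (\pi_(forest 1) g) = \pi_(forest 0) (link (g := g) id).
Proof.
apply/forest_eqP; case/isoP: (iso_repr g) => p bp pE.
exact: iso_link bp pE _.
Qed.

Lemma is_connected_pi (n : nat) (g : graph n) :
  is_connected (\pi_(forest n) g) = connected g.
Proof. exact/iso_connected/iso_repr. Qed.

(* the set T of rooted trees without aromas *)
Definition rtree := {x : forest 1 | is_connected x}.

(* F_0 together with the empty scalar, which is None *)
Definition scalar := option (forest 0).

Definition smul (a b : scalar) : scalar :=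
  match a, b with
  | Some x, Some y => Some (jux x y)
  | None, _ => b
  | _, None => a
  end.

Definition sjux (n : nat) (a : scalar) (x : forest n) : forest n :=
  if a is Some y then jux y x else x.

(* Span 0 and Span 1 are Omega_0 and Omega_1; Omega_2 is contained in Span 2. *)
Definition Span (R : realType) (n : nat) := {malg R[forest n]}.

Definition wedge2 (R : realType) (psi : scalar) (t t' : rtree) : Span R 2 :=
  2^-1 *: (<< sjux psi (jux (val t) (val t')) >>
           - << sjux psi (jux (val t') (val t)) >>).

Definition dH_forest (R : realType) (n : nat) (x : forest n.+1) : Span R n :=
  \sum_(u : nodes (repr x)) << \pi_(forest n) (link (fun _ => u)) >>.

Lemma dH_forest_pi (R : realType) (n : nat) (g : graph n.+1) :
  dH_forest R (\pi_(forest n.+1) g) =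
    \sum_(u : nodes g) << \pi_(forest n) (link (fun _ => u)) >>.
Proof.
case/isoP: (iso_repr g) => p bp pE; rewrite /dH_forest [RHS](reindex p).
  apply: eq_bigr => u _; congr << _ >>; apply/forest_eqP.
  exact: iso_link bp pE _.
by case: bp => q pK qK; exists q => ? _; [exact: pK|exact: qK].
Qed.

Definition dH (R : realType) (n : nat) (f : Span R n.+1) : Span R n :=
  \sum_(x <- msupp f) f@_x *: dH_forest R x.

Definition Psi (R : realType) (f : Span R 1) : Prop := dH f = 0.

Section Bases.
Variables (R : realType) (V : lmodType R).
Implicit Types B K : V -> Prop.

Definition lin_indep B : Prop :=
  forall (s : seq V) (c : V -> R), uniq s -> (forall v, v \in s -> B v) ->
    \sum_(v <- s) c v *: v = 0 -> forall v, v \in s -> c v = 0.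

Definition in_span B (w : V) : Prop :=
  exists (s : seq V) (c : V -> R),
    (forall v, v \in s -> B v) /\ w = \sum_(v <- s) c v *: v.

Definition is_basis K B : Prop :=
  [/\ forall v, B v -> K v, lin_indep B & forall v, K v -> in_span B v].

End Bases.

Definition total_order (T : Type) (le : rel T) : Prop :=
  [/\ antisymmetric le, transitive le & total le].

(* t_1 < ... < t_k is t 0 < ... < t k.+1, and t_l with 2 <= l is t l with
   l != 0; phi is arbitrary in F_0 together with the empty scalar, except that
   every aroma varphi(s) of phi, with s a rooted tree, has its s among
   t_1, ..., t_k.  Thus t_1, ..., t_k are all the trees whose looped version
   occurs in phi varphi(t_1) ... varphi(t_k), possibly several times.  Without
   this condition phi could absorb the factors varphi(t_i), k = 2 would already
   give the whole family, and this family would be linearly dependent: for three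
   trees a < b < c it would contain the images of varphi(c) a /\ b,
   varphi(b) a /\ c and varphi(a) b /\ c, and with one, two and three nodes in
   a, b and c, they give more elements than the dimension of the kernel. *)
Definition B_Psi (R : realType) (le : rel rtree) (v : Span R 1) : Prop :=
  exists (k : nat) (phi : scalar) (t : 'I_k.+2 -> rtree) (l : 'I_k.+2),
    let loop i : scalar := Some (attach_loop (val (t i))) in
    [/\ forall i j : 'I_k.+2, (i < j)%N -> le (t i) (t j) && (t i != t j),
        l != ord0,
        forall (s : rtree) (psi : scalar),
          phi = smul psi (Some (attach_loop (val s))) -> exists i, s = t i
      & v = dH (wedge2 R
              (smul phi (\big[smul/None]_(i | (i != ord0) && (i != l)) loop i))
              (t ord0) (t l))].

(* Main.v *)
From HB Require Import structures.
Require Import Defs.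
From mathcomp Require Import all_boot all_order all_algebra.
From mathcomp Require Import generic_quotient finmap.
From mathcomp Require Import boolp reals.
From mathcomp.multinomials Require Import monalg.

(** Write phi(t) for the tree t with a self-loop attached to its root.  Every
    aromatic tree is psi t for a unique scalar psi and a unique tree t without
    aromas ([aromatic_tree_split], [sjux_tree_inj]), and among the terms of
    d_H(psi t) only psi phi(t), where the new edge is a self-loop, has more
    self-loops than psi t ([dH_forest_lead]).  So d_H is triangular for the
    number of self-loops, with leading term the linear map phi, and it suffices
    to understand the fibres of phi on the basis of aromatic trees.

    Looped trees behave as primes: if psi phi(t) = psi' phi(t'), then either
    (psi, t) = (psi', t') or psi = chi phi(t') and psi' = chi phi(t) for some chi
    ([attach_loop_fiber], [smul_looped_eq]).  Hence a nonempty fibre of phi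
    consists of one aromatic tree for each looped tree that divides its image,
    and it contains exactly one minimal element psi t, in which t precedes all
    the trees s such that phi(s) divides psi.  An aromatic tree that is not
    minimal is psi phi(t) t', where psi t t' is a minimal pair: t < t' and t
    precedes all looped divisors of psi.  Minimal pairs are exactly what the
    factors t_1, t_l and the scalars of the family B_Psi range over ([B_PsiP]).

    For a minimal pair the element d_H(psi t /\ t') lies in the kernel, because
    d_H d_H kills wedges ([dH_dH_wedge2]), and its terms with the most self-loops
    are, up to the factor 1/2, psi phi(t') t - psi phi(t) t'
    ([dH_wedge2_lead]): the second aromatic tree determines the pair, while the
    first one is minimal.  Three consequences of triangularity conclude, over
    arbitrary index types ([triangular_basis]).  The family is independent, since
    a term with the most self-loops in a relation is the only one to involve its
    leading aromatic tree.  It spans the whole space modulo the minimal aromatic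
    trees, by replacing leading aromatic trees by minimal ones and by terms with
    fewer self-loops.  And a combination of minimal aromatic trees in the kernel
    is 0, as phi is injective on minimal aromatic trees; so what is left of an
    element of the kernel after the reduction vanishes. *)

Set Implicit Arguments.
Unset Strict Implicit.
Unset Printing Implicit Defensive.

Import GRing.Theory Defs.
Local Open Scope ring_scope.
Local Open Scope quotient_scope.

(** * Presentations of forests by successor functions on finite types *)

Definition is_morph (n : nat) (T T' : Type) (s : T -> T + 'I_n)
    (s' : T' -> T' + 'I_n) (p : T -> T') : Prop :=
  forall v, s' (p v) = map_node p (s v).

(** Working with any finite type of nodes, instead of with 'I_m, makes disjoint
    unions and subgraphs into sum types and subtypes, so that identities between
    forests become explicit bijections. *)
Definition presents (n : nat) (T : finType) (s : T -> T + 'I_n) (x : forest n) :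
    Prop :=
  exists2 p : T -> nodes (repr x), bijective p & is_morph s (@succ n (repr x)) p.

Definition edge_sum (p q : nat) (T T' : Type) (s : T -> T + 'I_p)
    (s' : T' -> T' + 'I_q) (v : T + T') : (T + T') + 'I_(p + q) :=
  match v with
  | inl a => match s a with inl w => inl (inl w) | inr i => inr (lshift q i) end
  | inr b => match s' b with inl w => inl (inr w) | inr i => inr (rshift p i) end
  end.

Definition edge_link (n : nat) (T : Type) (s : T -> T + 'I_n.+1) (f : T -> T)
    (v : T) : T + 'I_n :=
  match s v with
  | inl w => inl w
  | inr i => if unlift ord_max i is Some j then inr j else inl (f v)
  end.

Definition loop (n : nat) (x : forest n.+1) : forest n :=
  \pi_(forest n) (link (g := repr x) id).

Lemma map_node_comp (A B C D : Type) (p : A -> B) (q : B -> C) (x : A + D) :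
  map_node (q \o p) x = map_node q (map_node p x).
Proof. by case: x. Qed.

Lemma presents_repr (n : nat) (x : forest n) : presents (@succ n (repr x)) x.
Proof. by exists id; [exists id | move=> v; case: (succ v)]. Qed.

Lemma presents_pi (n : nat) (g : graph n) :
  presents (@succ n g) (\pi_(forest n) g).
Proof.
have := iso_repr g; rewrite iso_sym => /isoP[p bp pE].
by exists p.
Qed.

Lemma presents_bij (n : nat) (T T' : finType) (s : T -> T + 'I_n)
    (s' : T' -> T' + 'I_n) (x : forest n) (p : T' -> T) :
  presents s x -> bijective p -> is_morph s' s p -> presents s' x.
Proof.
case=> q bq qE bp pE; exists (q \o p); first exact: bij_comp.
by move=> v /=; rewrite qE pE map_node_comp.
Qed.

Lemma presents_eqfun (n : nat) (T : finType) (s s' : T -> T + 'I_n)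
    (x : forest n) :
  presents s x -> s =1 s' -> presents s' x.
Proof.
move=> sx ss'; apply: (presents_bij (p := id) sx); first by exists id.
by move=> v; rewrite ss'; case: (s' v).
Qed.

Lemma presents_morph (n : nat) (T T' : finType) (s : T -> T + 'I_n)
    (s' : T' -> T' + 'I_n) (x : forest n) :
  presents s x -> presents s' x ->
  exists p : T -> T', exists q : T' -> T,
    [/\ cancel p q, cancel q p, is_morph s s' p & is_morph s' s q].
Proof.
case=> p [p' pK p'K] pE [q [q' qK q'K] qE].
exists (q' \o p), (p' \o q); split.
- by move=> v /=; rewrite q'K pK.
- by move=> v /=; rewrite p'K qK.
- move=> v /=; have := pE v; rewrite -{1}(q'K (p v)) qE.
  case: (s v) => [w|i]; case: (s' _) => [w'|i'] //= [E]; last by rewrite E.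
  by rewrite -E qK.
- move=> v /=; have := qE v; rewrite -{1}(p'K (q v)) pE.
  case: (s' v) => [w|i]; case: (s _) => [w'|i'] //= [E]; last by rewrite E.
  by rewrite -E pK.
Qed.

Lemma presents_inj (n : nat) (T : finType) (s : T -> T + 'I_n)
    (x y : forest n) :
  presents s x -> presents s y -> x = y.
Proof.
move=> sx [c bc cE]; rewrite -[x]reprK -[y]reprK; apply/forest_eqP/isoP.
have [a [b [aK bK _ bE]]] := presents_morph sx (presents_repr x).
exists (c \o b); first by apply: bij_comp bc _; exists a.
by move=> v /=; rewrite cE bE map_node_comp.
Qed.

Lemma presents_eq (n : nat) (T T' : finType) (s : T -> T + 'I_n)
    (s' : T' -> T' + 'I_n) (x y : forest n) (p : T -> T') (q : T' -> T) :
  presents s x -> presents s' y -> cancel p q -> cancel q p ->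
  is_morph s s' p -> x = y.
Proof.
move=> sx sy pK qK pE; apply: (presents_inj sx).
by apply: (presents_bij sy) pE; exists q.
Qed.

Lemma presents_jux (p q : nat) (T T' : finType) (s : T -> T + 'I_p)
    (s' : T' -> T' + 'I_q) (x : forest p) (y : forest q) :
  presents s x -> presents s' y -> presents (edge_sum s s') (jux x y).
Proof.
case=> a [a' aK a'K] aE [b [b' bK b'K] bE].
pose f (v : T + T') : nodes (union (repr x) (repr y)) :=
  unsplit (match v with inl c => inl (a c) | inr c => inr (b c) end).
apply: (presents_bij (presents_pi (union (repr x) (repr y))) (p := f)).
  exists (fun v => match split v with inl c => inl (a' c) | inr c => inr (b' c) end).
    by case=> c; rewrite /f unsplitK ?aK ?bK.
  move=> v; rewrite -[RHS]splitK; congr unsplit.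
  by rewrite /f; case: (split v) => c; rewrite ?a'K ?b'K.
case=> c; rewrite /succ /f /= ffunE.
  rewrite (unsplitK (inl (a c))); have := aE c; rewrite /succ => ->.
  by case: (s c).
rewrite (unsplitK (inr (b c))); have := bE c; rewrite /succ => ->.
by case: (s' c).
Qed.

Lemma presents_link (n : nat) (g : graph n.+1) (f : nodes g -> nodes g) :
  presents (edge_link (@succ _ g) f) (\pi_(forest n) (link f)).
Proof.
have fP : presents (T := nodes g) (@succ _ (link f)) (\pi_(forest n) (link f)).
  exact (presents_pi (link f)).
by apply: (presents_eqfun fP) => v; rewrite /succ /= ffunE.
Qed.

Lemma presents_loop (n : nat) (T : finType) (s : T -> T + 'I_n.+1)
    (x : forest n.+1) :
  presents s x -> presents (edge_link s id) (loop x).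
Proof.
case=> p bp pE; apply: (presents_bij (presents_link id)) bp _ => v.
rewrite /edge_link pE; case: (s v) => //= i.
by case: (unlift _ _).
Qed.

Lemma presents_rootP (n : nat) (T : finType) (s : T -> T + 'I_n)
    (x : forest n) (i : 'I_n) :
  presents s x -> exists r, forall v, (s v == inr i) = (v == r).
Proof.
case=> p [q pK qK] pE; have /andP[_ /forallP/(_ i)] := valP (repr x).
case/eqP/mem_card1 => r rP; exists (q r) => v.
rewrite -(can2_eq pK qK); have := rP (p v); rewrite !inE => <-.
have := pE v; rewrite /succ => ->.
by case: (s v) => //= j; rewrite !(inj_eq inr_inj).
Qed.

Lemma presents_exists (n : nat) (T : finType) (s : T -> T + 'I_n) :
  (0 < #|T|)%N -> (forall i, exists r, forall v, (s v == inr i) = (v == r)) ->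
  exists x, presents s x.
Proof.
move=> T0 sr.
pose f : {ffun 'I_#|T| -> 'I_#|T| + 'I_n} :=
  [ffun v => map_node enum_rank (s (enum_val v))].
pose pg : pregraph n := Tagged (fun m => {ffun 'I_m -> 'I_m + 'I_n}) f.
have fE v : f v = map_node enum_rank (s (enum_val v)) by rewrite ffunE.
have vg : valid pg.
  apply/andP; split=> //; apply/forallP => i; have [r rP] := sr i.
  rewrite -(card1 (enum_rank r)); apply/eqP/eq_card => v; rewrite !inE /= fE.
  rewrite -[v]enum_valK (inj_eq enum_rank_inj) -rP enum_valK.
  by case: (s _) => //= j; rewrite !(inj_eq inr_inj).
exists (\pi_(forest n) (exist _ pg vg)).
apply: (presents_bij (presents_pi (exist _ pg vg : graph n)) (p := @enum_rank T)).
  exact: enum_rank_bij.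
by move=> v; rewrite /succ /= fE enum_rankK.
Qed.

(** * The commutative monoid of scalars *)

(** The empty scalar is presented by the empty type, so that it needs no
    separate treatment in the identities below. *)
Definition spresents (T : finType) (s : T -> T + 'I_0) (a : scalar) : Prop :=
  if a is Some x then presents s x else #|T| = 0%N.

Lemma spresents_some (a : scalar) :
  exists (T : finType) (s : T -> T + 'I_0), spresents s a.
Proof.
case: a => [x|].
  by exists (nodes (repr x)), (@succ _ (repr x)); exact: presents_repr.
by exists void, (fun v => inl v); rewrite /= card_void.
Qed.

Lemma spresents_exists (T : finType) (s : T -> T + 'I_0) :
  exists a, spresents s a.
Proof.
have [T0|T0] := posnP #|T|; first by exists None.
by have [|x sx] := presents_exists (s := s) T0; [case | exists (Some x)].
Qed.

Lemma spresents_eq (T T' : finType) (s : T -> T + 'I_0) (s' : T' -> T' + 'I_0)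
    (a b : scalar) (p : T -> T') (q : T' -> T) :
  spresents s a -> spresents s' b -> cancel p q -> cancel q p ->
  is_morph s s' p -> a = b.
Proof.
move=> sa sb pK qK pE.
have eT : #|T| = #|T'| by apply: bij_eq_card; exists q.
case: a b sa sb => [x|] [y|] //=.
- by move=> sx sy; rewrite (presents_eq sx sy pK qK pE).
- move=> [f [f' _ _] _] T0; move: eT; rewrite T0 => /card0_eq T_0.
  case/andP: (valP (repr x)) => n0 _.
  by have := T_0 (f' (Ordinal n0)).
- move=> T0 [f [f' _ _] _]; move: eT; rewrite T0 => /esym/card0_eq T_0.
  case/andP: (valP (repr y)) => n0 _.
  by have := T_0 (f' (Ordinal n0)).
Qed.

Lemma spresents_smul (T T' : finType) (s : T -> T + 'I_0)
    (s' : T' -> T' + 'I_0) (a b : scalar) :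
  spresents s a -> spresents s' b ->
  spresents (edge_sum s s' : T + T' -> (T + T') + 'I_0) (smul a b).
Proof.
case: a b => [x|] [y|] //=; first exact: presents_jux.
- move=> sx T0; have F (w : T') : False by have := card0_eq T0 w.
  pose f (v : T + T') : T :=
    match v with inl w => w | inr w => match F w with end end.
  apply: (presents_bij (p := f) sx).
    by exists inl => // -[//|w]; case: (F w).
  by move=> [w|w /=]; [rewrite /=; case: (s w) => // -[] | case: (F w)].
- move=> T0 sx; have F (w : T) : False by have := card0_eq T0 w.
  pose f (v : T + T') : T' :=
    match v with inr w => w | inl w => match F w with end end.
  apply: (presents_bij (p := f) sx).
    by exists inr => // -[w|//]; case: (F w).
  by move=> [w|w /=]; [case: (F w) | case: (s' w) => // -[]].
- by move=> T0 T0'; rewrite card_sum T0 T0'.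
Qed.

Lemma presents_sjux (n : nat) (T T' : finType) (s : T -> T + 'I_0)
    (s' : T' -> T' + 'I_n) (a : scalar) (x : forest n) :
  spresents s a -> presents s' x ->
  presents (edge_sum s s' : T + T' -> (T + T') + 'I_n) (sjux a x).
Proof.
case: a => [y|] /=; first exact: presents_jux.
move=> T0 sx; have F (w : T) : False by have := card0_eq T0 w.
pose f (v : T + T') : T' :=
  match v with inr w => w | inl w => match F w with end end.
apply: (presents_bij (p := f) sx).
  by exists inr => // -[w|//]; case: (F w).
move=> [w|w /=]; first by case: (F w).
by case: (s' w) => //= i; congr inr; exact: val_inj.
Qed.

Lemma smulC : commutative smul.
Proof.
move=> a b; have [[T [s sa]] [T' [s' sb]]] := (spresents_some a, spresents_some b).
apply: (spresents_eq (spresents_smul sa sb) (spresents_smul sb sa)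
  (p := fun v => match v with inl w => inr w | inr w => inl w end)
  (q := fun v => match v with inl w => inr w | inr w => inl w end)).
- by case.
- by case.
- by case=> w /=; [case: (s w) => // -[] | case: (s' w) => // -[]].
Qed.

Definition sumA (A B C : Type) (v : A + (B + C)) : (A + B) + C :=
  match v with
  | inl a => inl (inl a) | inr (inl b) => inl (inr b) | inr (inr c) => inr c
  end.

Definition sumAr (A B C : Type) (v : (A + B) + C) : A + (B + C) :=
  match v with
  | inl (inl a) => inl a | inl (inr b) => inr (inl b) | inr c => inr (inr c)
  end.

Lemma sumAK (A B C : Type) : cancel (@sumA A B C) (@sumAr A B C).
Proof. by case=> [|[]]. Qed.

Lemma sumArK (A B C : Type) : cancel (@sumAr A B C) (@sumA A B C).
Proof. by case=> [[]|]. Qed.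

Lemma smulA : associative smul.
Proof.
move=> a b c; have [T [s sa]] := spresents_some a.
have [[T' [s' sb]] [T'' [s'' sc]]] := (spresents_some b, spresents_some c).
apply: (spresents_eq (spresents_smul sa (spresents_smul sb sc))
  (spresents_smul (spresents_smul sa sb) sc) (@sumAK _ _ _) (@sumArK _ _ _)).
case=> [w|[w|w]] /=; first by case: (s w) => // -[].
  by case: (s' w) => // -[].
by case: (s'' w) => // -[].
Qed.

HB.instance Definition _ := Monoid.isComLaw.Build scalar None smul smulA smulC
  (fun a => erefl).

Lemma sjux_jux (p q : nat) (a : scalar) (x : forest p) (y : forest q) :
  sjux a (jux x y) = jux (sjux a x) y.
Proof.
have [T [s sa]] := spresents_some a.
have [sx sy] := (presents_repr x, presents_repr y).
apply: (presents_eq (presents_sjux sa (presents_jux sx sy))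
  (presents_jux (presents_sjux sa sx) sy) (@sumAK _ _ _) (@sumArK _ _ _)).
case=> [w|[w|w]] /=; first by case: (s w) => // -[].
  by case: (succ w) => //= i; congr inr; exact: val_inj.
by case: (succ w) => //= i; congr inr; exact: val_inj.
Qed.

Lemma unlift_ord1 (i j : 'I_1) : unlift i j = None.
Proof. by case: unliftP => // -[]. Qed.

(** Linking the last root to itself only alters its own component. *)
Lemma attach_loop_sjux (a : scalar) (t : forest 1) :
  Some (attach_loop (sjux a t)) = smul a (Some (attach_loop t)).
Proof.
have [T [s sa]] := spresents_some a.
have st := presents_repr t.
have sl : spresents (edge_link (@succ _ (repr t)) id) (Some (attach_loop t)).
  exact (presents_loop st).
have sl' := presents_loop (presents_sjux sa st).
apply: (spresents_eq (sl' : spresents _ (Some (attach_loop (sjux a t))))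
  (spresents_smul sa sl) (p := id) (q := id)) => //.
case=> w; rewrite /edge_link /=; first by case: (s w) => // -[].
by case: (succ w) => //= i; rewrite !unlift_ord1.
Qed.

Definition sumAC (A B C : Type) (v : A + (B + C)) : (A + C) + B :=
  match v with
  | inl a => inl (inl a) | inr (inl b) => inr b | inr (inr c) => inl (inr c)
  end.

Definition sumACr (A B C : Type) (v : (A + C) + B) : A + (B + C) :=
  match v with
  | inl (inl a) => inl a | inl (inr c) => inr (inr c) | inr b => inr (inl b)
  end.

Lemma sumACK (A B C : Type) : cancel (@sumAC A B C) (@sumACr A B C).
Proof. by case=> [|[]]. Qed.

Lemma sumACrK (A B C : Type) : cancel (@sumACr A B C) (@sumAC A B C).
Proof. by case=> [[]|]. Qed.

Lemma loop_sjux_jux (a : scalar) (t t' : forest 1) :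
  loop (sjux a (jux t t')) = sjux (smul a (Some (attach_loop t'))) t.
Proof.
have [T [s sa]] := spresents_some a.
have [st st'] := (presents_repr t, presents_repr t').
have sl : spresents (edge_link (@succ _ (repr t')) id) (Some (attach_loop t')).
  exact (presents_loop st').
apply: (presents_eq (presents_loop (presents_sjux sa (presents_jux st st')))
  (presents_sjux (spresents_smul sa sl) st) (@sumACK _ _ _) (@sumACrK _ _ _)).
case=> [w|[w|w]]; rewrite /edge_link /=; first by case: (s w) => // -[].
  case: (succ w) => //= i; case: unliftP => [j Ej|/(congr1 val) /=].
    by congr inr; rewrite !ord1.
  by rewrite ord1.
case: (succ w) => //= i.
have -> : rshift 0 (rshift 1 i) = ord_max by apply: val_inj; rewrite /= ord1.
by rewrite unlift_none unlift_ord1.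
Qed.

Lemma presents_swap (a : scalar) (t t' : forest 1) (T : finType)
    (s : T -> T + 'I_2) :
  presents s (sjux a (jux t t')) ->
  presents
    (fun v => match s v with inl w => inl w | inr i => inr (rev_ord i) end)
    (sjux a (jux t' t)).
Proof.
have [T0 [s0 sa]] := spresents_some a.
have [st st'] := (presents_repr t, presents_repr t').
have s1 := presents_sjux sa (presents_jux st st').
have s2 := presents_sjux sa (presents_jux st' st).
move=> sx; have [p [q [pK qK pE qE]]] := presents_morph sx s1.
pose f (A B C : Type) (v : A + (B + C)) : A + (C + B) :=
  match v with
  | inl a => inl a | inr (inl b) => inr (inr b) | inr (inr c) => inr (inl c)
  end.
have fK A B C : cancel (@f A B C) (@f A C B) by case=> [|[]].
apply: (presents_bij s2 (p := @f _ _ _ \o p)).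
  apply: bij_comp; first by exists (@f _ _ _).
  by exists q.
move=> v; rewrite map_node_comp.
have -> : map_node p
    (match s v with inl w => inl w | inr i => inr (rev_ord i) end) =
  match map_node p (s v) with inl w => inl w | inr i => inr (rev_ord i) end.
  by case: (s v).
rewrite -pE /=; case: (p v) => [w|[w|w]] /=; first by case: (s0 w) => // -[].
  by case: (succ w) => //= i; congr inr; apply: val_inj; rewrite /= ord1.
by case: (succ w) => //= i; congr inr; apply: val_inj; rewrite /= ord1.
Qed.

(** * Splitting off the component of a root *)

(** This is connectedness in the form in which it is used: a property that is
    constant along the edges is constant. *)
Definition edge_connected (n : nat) (T : Type) (s : T -> T + 'I_n) : Prop :=
  forall P : T -> bool, (forall u w, s u = inl w -> P u = P w) ->
    forall u v, P u = P v.

Lemma connectedP (n : nat) (g : graph n) :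
  connected g <-> edge_connected (@succ n g).
Proof.
set adj := fun u v : nodes g => (succ u == inl v) || (succ v == inl u).
have adjC : symmetric adj by move=> u v; rewrite /adj orbC.
split=> [/forallP gc P Pe u v | gc].
  have /forallP/(_ v) := gc u; apply: closed_connect => {}u {}v.
  by case/orP => /eqP/Pe; rewrite unfold_in => E; rewrite [RHS]unfold_in.
apply/forallP => u; apply/forallP => v.
rewrite -(gc (connect adj u) _ u v) ?connect0 // => w w' ww'.
have cww' : connect adj w w' by apply: connect1; rewrite /adj ww' eqxx.
have cw'w : connect adj w' w by rewrite (sym_connect_sym adjC).
by apply/idP/idP => /connect_trans; apply.
Qed.

Lemma edge_connected_morph (n : nat) (T T' : Type) (s : T -> T + 'I_n)
    (s' : T' -> T' + 'I_n) (p : T -> T') (q : T' -> T) :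
  is_morph s s' p -> cancel q p -> edge_connected s -> edge_connected s'.
Proof.
move=> pE qK sc P Pe u v; rewrite -(qK u) -(qK v).
apply: (sc (P \o p)) => a b ab /=; apply: Pe.
by rewrite pE ab.
Qed.

Lemma presents_connected (n : nat) (T : finType) (s : T -> T + 'I_n)
    (x : forest n) :
  presents s x -> is_connected x <-> edge_connected s.
Proof.
move=> sx; have [p [q [pK qK pE qE]]] := presents_morph sx (presents_repr x).
rewrite /is_connected; split=> [/connectedP|] c.
  exact: edge_connected_morph qE pK c.
by apply/connectedP; exact: edge_connected_morph pE qK c.
Qed.

(** The nodes from which the last root can be reached are closed under
    predecessors and successors and contain no other root, so that they form a
    summand. *)
Lemma split_component (n : nat) (T : finType) (s : T -> T + 'I_(n + 1)) :
  (forall i, exists r, forall v, (s v == inr i) = (v == r)) ->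
  exists (T1 T2 : finType) (s1 : T1 -> T1 + 'I_n) (s2 : T2 -> T2 + 'I_1)
      (p : T1 + T2 -> T),
    [/\ edge_connected s2,
        forall i, exists r, forall v, (s1 v == inr i) = (v == r),
        forall i, exists r, forall v, (s2 v == inr i) = (v == r),
        bijective p & is_morph (edge_sum s1 s2) s p].
Proof.
move=> sr; have [r rP] := sr (rshift n ord0).
pose e : rel T := fun u w => s u == inl w.
pose A v := connect e v r.
have sr0 : s r = inr (rshift n ord0) by apply/eqP; rewrite rP.
have Ae u w : s u = inl w -> A u = A w.
  move=> uw; apply/idP/idP; last first.
    by apply: connect_trans; apply: connect1; rewrite /e uw.
  case/connectP=> [[|w' l]] /=; first by move=> _ E; rewrite -E sr0 in uw.
  rewrite {1}/e uw => /andP[/eqP[<-] wl] rl.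
  by apply/connectP; exists l.
have Ar v i : A v -> s v = inr i -> i = rshift n ord0.
  case/connectP=> [[|w' l]] /=; first by move=> _ <-; rewrite sr0 => -[].
  by rewrite {1}/e => /andP[/eqP -> _].
have Arr v : s v = inr (rshift n ord0) -> A v.
  by move/eqP; rewrite rP => /eqP ->; exact: connect0.
have f1 (v : {v | ~~ A v}) : exists c : {v | ~~ A v} + 'I_n,
    s (val v) = match c with inl w => inl (val w) | inr i => inr (lshift 1 i) end.
  case: v => v nAv /=; case E: (s v) => [w|i].
    have nAw : ~~ A w by rewrite -(Ae _ _ E).
    by exists (inl (exist _ w nAw)).
  case: (splitP i) => j ij; first by exists (inr j); congr inr; exact: val_inj.
  case/negP: nAv; apply: Arr; rewrite E; congr inr; apply: val_inj.
  by rewrite /= ij (ord1 j).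
have f2 (v : {v | A v}) : exists c : {v | A v} + 'I_1,
    s (val v) = match c with inl w => inl (val w) | inr i => inr (rshift n i) end.
  case: v => v Av /=; case E: (s v) => [w|i].
    have Aw : A w by rewrite -(Ae _ _ E).
    by exists (inl (exist _ w Aw)).
  by exists (inr ord0); rewrite (Ar _ _ Av E).
have [s1 s1E] := fin_all_exists f1.
have [s2 s2E] := fin_all_exists f2.
pose p (v : {v | ~~ A v} + {v | A v}) : T :=
  match v with inl w => val w | inr w => val w end.
exists {v | ~~ A v}, {v | A v}, s1, s2, p; split.
- have Acr : A r by exact: connect0.
  pose r' : {v | A v} := exist _ r Acr.
  suff cr (P : {v | A v} -> bool) :
      (forall u w, s2 u = inl w -> P u = P w) -> forall u, P u = P r'.
    by move=> P Pe u v; rewrite !(cr P Pe).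
  (* Paths to r stay in A, so that P' takes the values of P all along them. *)
  move=> Pe u; pose P' v := if insub v is Some w then P w else true.
  have P'E (w : {v | A v}) : P' (val w) = P w by rewrite /P' valK.
  rewrite -!P'E; have /connectP[l] := valP u.
  rewrite [val r']/=; move: (val u) => v {u}.
  elim: l v => [|w l IHl] v /=; first by move=> _ ->.
  case/andP=> /eqP vw wl rl; rewrite -(IHl w wl rl).
  rewrite /P'; case: (insubP _ v) => [v' Av v'E|/negbTE nAv]; last first.
    by rewrite insubF // -(Ae _ _ vw).
  have /= Aw : A w by rewrite -(Ae _ _ vw).
  rewrite insubT; apply: Pe.
  have := s2E v'; rewrite v'E vw; case: (s2 v') => // w' [ww'].
  by congr inl; apply: val_inj; rewrite /= ww'.
- move=> i; have [a aP] := sr (lshift 1 i).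
  have sa : s a = inr (lshift 1 i) by apply/eqP; rewrite aP.
  have nAa : ~~ A a.
    by apply/negP => Aa; have /eqP := Ar _ _ Aa sa; rewrite eq_lrshift.
  exists (exist _ a nAa) => v; rewrite -val_eqE /= -aP s1E.
  by case: (s1 v) => // j; rewrite !(inj_eq inr_inj) (inj_eq (@lshift_inj _ _)).
- move=> i; have Acr : A r by exact: connect0.
  exists (exist _ r Acr) => v; rewrite -val_eqE /= -rP s2E (ord1 i).
  by case: (s2 v) => // j; rewrite !(inj_eq inr_inj) (inj_eq (@rshift_inj _ _)).
- have p' v : exists c, p c = v.
    have [Av|nAv] := boolP (A v); first by exists (inr (exist _ v Av)).
    by exists (inl (exist _ v nAv)).
  have [q qK] := fin_all_exists p'; exists q => // v.
  have := qK (p v).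
  case: v => v; case: (q _) => w /= E.
  + by congr inl; exact: val_inj.
  + by have := valP v; rewrite /= -E (valP w).
  + by have := valP w; rewrite /= E (valP v).
  + by congr inr; exact: val_inj.
- case=> v /=; first by rewrite s1E; case: (s1 v).
  by rewrite s2E; case: (s2 v).
Qed.

Lemma tree_presents (T : finType) (s : T -> T + 'I_1) :
  (forall i, exists r, forall v, (s v == inr i) = (v == r)) ->
  edge_connected s -> exists t : rtree, presents s (val t).
Proof.
move=> sr sc; have [r _] := sr ord0.
have [|x sx] := presents_exists (s := s) _ sr.
  by apply/card_gt0P; exists r.
have xc : is_connected x by apply/(presents_connected sx).
by exists (exist _ x xc).
Qed.

Lemma aromatic_tree_split (x : forest 1) :
  exists (a : scalar) (t : rtree), x = sjux a (val t).
Proof.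
have sx := presents_repr x.
have [|T1 [T2 [s1 [s2 [p [c2 r1 r2 bp pE]]]]]] :=
  @split_component 0 _ (@succ _ (repr x)).
  by move=> i; exact: presents_rootP sx.
have [t st] := tree_presents r2 c2; have [a sa] := spresents_exists s1.
exists a, t; apply: (presents_inj _ (presents_sjux sa st)).
exact: presents_bij sx bp pE.
Qed.

Lemma forest2_split (x : forest 2) :
  exists (a : scalar) (t t' : rtree), x = sjux a (jux (val t) (val t')).
Proof.
have sx := presents_repr x.
have [|T1 [T2 [s1 [s2 [p [c2 r1 r2 bp pE]]]]]] :=
  @split_component 1 _ (@succ _ (repr x)).
  by move=> i; exact: presents_rootP sx.
have [t' st'] := tree_presents r2 c2.
have [r _] := r1 ord0.
have [|y sy] := presents_exists (s := s1) _ r1.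
  by apply/card_gt0P; exists r.
have [a [t yE]] := aromatic_tree_split y.
exists a, t, t'; rewrite sjux_jux -yE.
apply: (presents_inj _ (presents_jux sy st')).
exact: presents_bij sx bp pE.
Qed.

(** The root of T2 goes to a root, hence to T2', as T1' has none; and T2 is
    connected, while no edge joins T1' and T2'. *)
Lemma morph_component (T1 T2 T1' T2' : finType) (s1 : T1 -> T1 + 'I_0)
    (s2 : T2 -> T2 + 'I_1) (s1' : T1' -> T1' + 'I_0) (s2' : T2' -> T2' + 'I_1)
    (p : T1 + T2 -> T1' + T2') (t : forest 1) :
  presents s2 t -> edge_connected s2 ->
  is_morph (edge_sum s1 s2 : _ -> _ + 'I_1) (edge_sum s1' s2') p ->
  forall v, exists w, p (inr v) = inr w.
Proof.
move=> st sc pE v.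
have [r rP] := presents_rootP ord0 st.
pose P v := if p (inr v) is inr _ then true else false.
suff : P v by rewrite /P; case: (p (inr v)) => // w _; exists w.
rewrite (sc P _ v r) => [|u w uw].
  have := pE (inr r); rewrite /P.
  have /= -> : s2 r = inr ord0 by apply/eqP; rewrite rP.
  by case: (p _) => //= w; case: (s1' w) => // -[].
have := pE (inr u); rewrite /P /= uw /=.
case: (p (inr u)) => u' /=; last by case: (s2' u') => // w' [<-].
by case: (s1' u') => [w' [<-]|[]].
Qed.

Lemma sjux_tree_inj (a a' : scalar) (t t' : rtree) :
  sjux a (val t) = sjux a' (val t') -> a = a' /\ t = t'.
Proof.
move=> E; have [T1 [s1 sa]] := spresents_some a.
have [T1' [s1' sa']] := spresents_some a'.
have [st st'] := (presents_repr (val t), presents_repr (val t')).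
have s2c := proj1 (presents_connected st) (valP t).
have s2c' := proj1 (presents_connected st') (valP t').
have sx := presents_sjux sa st; have sx' := presents_sjux sa' st'.
rewrite -E in sx'.
have [p [q [pK qK pE qE]]] := presents_morph sx sx'.
have pr := morph_component st s2c pE; have qr := morph_component st' s2c' qE.
have pl v : exists w, p (inl v) = inl w.
  case E' : (p (inl v)) => [w|w]; first by exists w.
  by have [v'] := qr w; rewrite -E' pK.
have ql v : exists w, q (inl v) = inl w.
  case E' : (q (inl v)) => [w|w]; first by exists w.
  by have [v'] := pr w; rewrite -E' qK.
have [[p1 p1E] [p2 p2E]] := (fin_all_exists pl, fin_all_exists pr).
have [[q1 q1E] [q2 q2E]] := (fin_all_exists ql, fin_all_exists qr).
have p1K : cancel p1 q1.
  by move=> v; have := pK (inl v); rewrite p1E q1E => -[].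
have q1K : cancel q1 p1.
  by move=> v; have := qK (inl v); rewrite q1E p1E => -[].
have p2K : cancel p2 q2.
  by move=> v; have := pK (inr v); rewrite p2E q2E => -[].
have q2K : cancel q2 p2.
  by move=> v; have := qK (inr v); rewrite q2E p2E => -[].
split.
  apply: (spresents_eq sa sa' p1K q1K) => v.
  have := pE (inl v); rewrite p1E /=; case: (s1 v) => [w|[]//] /=.
  by rewrite p1E; case: (s1' _) => // w' [->].
apply/val_inj/(presents_eq st st' p2K q2K) => v.
have := pE (inr v); rewrite p2E /=; case: (succ v) => [w|i] /=.
  by rewrite p2E; case: (succ _) => // w' [->].
case: (succ _) => // j _; by rewrite !ord1.
Qed.

(** Two aromatic trees with the same looped version differ at most by the choice
    of the looped node that is turned back into a root.  If the two choices
    differ, cutting both loops gives a forest with two roots, whose decomposition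
    exhibits both aromatic trees. *)
Lemma attach_loop_fiber (x x' : forest 1) :
  attach_loop x = attach_loop x' ->
  x = x' \/ exists (a : scalar) (t t' : rtree),
    x = sjux (smul a (Some (attach_loop (val t')))) (val t) /\
    x' = sjux (smul a (Some (attach_loop (val t)))) (val t').
Proof.
move=> E; have [sx sx'] := (presents_repr x, presents_repr x').
have lx := presents_loop sx; have lx' := presents_loop sx'.
rewrite -[loop x']E in lx'.
have [p [q [pK qK pE qE]]] := presents_morph lx lx'.
have [r rP] := presents_rootP ord0 sx.
have [r' rP'] := presents_rootP ord0 sx'.
have sr : succ r = inr ord0 by apply/eqP; rewrite rP.
have sr' : succ r' = inr ord0 by apply/eqP; rewrite rP'.
have sE v : v != r ->
    exists2 w, succ v = inl w & edge_link (@succ _ (repr x)) id v = inl w.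
  rewrite -rP /edge_link; case: (succ v) => [w _|i]; first by exists w.
  by rewrite (ord1 i) eqxx.
have sE' v : v != r' ->
    exists2 w, succ v = inl w & edge_link (@succ _ (repr x')) id v = inl w.
  rewrite -rP' /edge_link; case: (succ v) => [w _|i]; first by exists w.
  by rewrite (ord1 i) eqxx.
have lr' : edge_link (@succ _ (repr x')) id r' = inl r'.
  by rewrite /edge_link sr' unlift_ord1.
have [prr'|prr'] := eqVneq (p r) r'.
  left; apply: (presents_eq sx sx' pK qK) => v.
  have [->|vr] := eqVneq v r; first by rewrite prr' sr sr'.
  have pvr' : p v != r' by rewrite -prr' (can_eq pK).
  have [w -> lv] := sE v vr; have [w' -> lv'] := sE' _ pvr'.
  by have := pE v; rewrite lv lv' => -[->].
(* z removes the edges of both loops, and numbers the root of x first. *)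
right; pose r2 := q r'.
have r2r : r2 != r by rewrite /r2 (can2_eq qK pK) eq_sym.
have [w sw lw] := sE _ r2r.
have wr2 : w = r2 by have := qE r'; rewrite lr' -/r2 lw /= => -[].
rewrite {w}wr2 in sw lw.
pose z v : nodes (repr x) + 'I_2 :=
  if v == r then inr ord0 else if v == r2 then inr ord_max else
  if succ v is inl w then inl w else inl v.
have [||y zy] := presents_exists (s := z).
- by apply/card_gt0P; exists r.
- case=> -[|[//|//]] ltn.
    exists r => v; rewrite /z; case: (eqVneq v r) => // vr.
    by case: ifP => // _; case: (succ v).
  exists r2 => v; rewrite /z; case: (eqVneq v r) => [->|vr].
    by rewrite [RHS]eq_sym (negbTE r2r).
  by case: ifP => // _; case: (succ v).
have [a [t [t' yE]]] := forest2_split y.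
exists a, t, t'; rewrite -!loop_sjux_jux; split.
  apply: (presents_inj sx); rewrite -yE.
  apply: (presents_eqfun (presents_loop zy)) => v.
  rewrite /edge_link /z; case: (eqVneq v r) => [->|vr].
    rewrite sr; case: unliftP => [j _|//].
    by rewrite ord1.
  case: (eqVneq v r2) => [->|vr2]; first by rewrite unlift_none sw.
  by have [w -> _] := sE _ vr.
(* For x' the roots of z have to be renumbered, as the last one is looped. *)
apply: (presents_inj sx'); rewrite yE in zy.
have := presents_loop (presents_swap zy) => /presents_bij.
apply; first by exists p; [exact: qK | exact: pK].
move=> v; rewrite /edge_link /z.
have [->|vr'] := eqVneq v r'.
  rewrite (negbTE r2r) eqxx /= sr'; case: unliftP => [j _|/(congr1 val)//].
  by rewrite ord1.
rewrite (can2_eq qK pK); have [w sv lv] := sE' _ vr'.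
have [vr|vr] := eqVneq v (p r).
  have -> : rev_ord (ord0 : 'I_2) = ord_max by exact: val_inj.
  rewrite unlift_none sv /=; congr (inl (q _)).
  have := pE r; rewrite -vr lv /edge_link sr unlift_ord1 /= => -[->].
  by rewrite vr.
rewrite (can_eq qK) (negbTE vr').
have qvr : q v != r by rewrite (can2_eq qK pK).
have [w' -> lqv] := sE _ qvr.
by have := qE v; rewrite lqv lv sv => -[->].
Qed.

(** * Divisibility of a scalar by looped trees *)

Definition looped (t : rtree) : scalar := Some (attach_loop (val t)).

Definition divides (t : rtree) (a : scalar) : Prop :=
  exists b, a = smul b (looped t).

Definition nloops (n : nat) (x : forest n) : nat :=
  #|[pred v | @succ n (repr x) v == inl v]|.

Definition snloops (a : scalar) : nat := if a is Some x then nloops x else 0.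

Lemma presents_nloops (n : nat) (T : finType) (s : T -> T + 'I_n)
    (x : forest n) :
  presents s x -> nloops x = #|[pred v | s v == inl v]|.
Proof.
case=> p bp pE; have [q pK qK] := bp.
rewrite /nloops -(on_card_preimset (f := p)); last by exists q => ? _.
rewrite -[RHS]cardsE; apply: eq_card => v; rewrite !inE pE.
by case: (s v) => // w /=; rewrite !(inj_eq inl_inj) (inj_eq (bij_inj bp)).
Qed.

Lemma spresents_nloops (T : finType) (s : T -> T + 'I_0) (a : scalar) :
  spresents s a -> snloops a = #|[pred v | s v == inl v]|.
Proof.
case: a => [x|] /=; first exact: presents_nloops.
by move=> T0; apply/esym/eq_card0 => v; have := card0_eq T0 v.
Qed.

Lemma snloops_smul (a b : scalar) :
  snloops (smul a b) = (snloops a + snloops b)%N.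
Proof.
have [T [s sa]] := spresents_some a; have [T' [s' sb]] := spresents_some b.
rewrite (spresents_nloops sa) (spresents_nloops sb).
rewrite (spresents_nloops (spresents_smul sa sb)) -!sum1_card.
rewrite big_sumType /=; congr (_ + _)%N; apply: eq_bigl => v; rewrite !inE /=.
  by case: (s v) => // w; rewrite !(inj_eq inl_inj).
by case: (s' v) => // w; rewrite (inj_eq inl_inj) (inj_eq inr_inj)
  (inj_eq inl_inj).
Qed.

(** Only an edge from the last root to itself creates a self-loop. *)
Lemma card_loops_link (n : nat) (T : finType) (s : T -> T + 'I_n.+1)
    (f : T -> T) (r : T) :
  (forall v, (s v == inr ord_max) = (v == r)) ->
  #|[pred v | edge_link s f v == inl v]| =
  (#|[pred v | s v == inl v]| + (f r == r))%N.
Proof.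
move=> rP; have sr : s r = inr ord_max by apply/eqP; rewrite rP.
rewrite (cardD1 r) (cardD1 r [pred v | s v == inl v]) !inE.
rewrite {1}/edge_link sr unlift_none (inj_eq inl_inj) add0n addnC.
congr (_ + _)%N; apply: eq_card => v; rewrite !inE.
have [//|vr /=] := eqVneq v r.
rewrite /edge_link; move: (rP v); rewrite (negbTE vr).
case: (s v) => [w|i] /=; first by rewrite !(inj_eq inl_inj).
rewrite (inj_eq inr_inj) => ni; case: unliftP => [//|ij].
by rewrite ij eqxx in ni.
Qed.

Lemma nloops_loop (n : nat) (x : forest n.+1) : nloops (loop x) = (nloops x).+1.
Proof.
have sx := presents_repr x; have [r rP] := presents_rootP ord_max sx.
rewrite (presents_nloops (presents_loop sx)) (presents_nloops sx).
by rewrite (card_loops_link id rP) eqxx addn1.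
Qed.

Lemma nloops_link (n : nat) (g : graph n.+1) (u : nodes g) :
  succ u != inr ord_max ->
  nloops (\pi_(forest n) (link (fun _ => u))) = nloops (\pi_(forest n.+1) g).
Proof.
move=> ur; have sg := presents_pi g; have [r rP] := presents_rootP ord_max sg.
rewrite (presents_nloops (presents_link (fun _ => u))) (presents_nloops sg).
by rewrite (card_loops_link _ rP) -rP (negbTE ur) addn0.
Qed.

Lemma snloops_looped (t : rtree) : (0 < snloops (looped t))%N.
Proof. by rewrite /= (nloops_loop (val t)). Qed.

Lemma sjux_looped (a : scalar) (t : rtree) :
  Some (attach_loop (sjux a (val t))) = smul a (looped t).
Proof. exact: attach_loop_sjux. Qed.

(** The fibres of the loop map, read through the unique decomposition of aromatic
    trees, show that looped trees are prime and can be cancelled. *)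
Lemma smul_looped_eq (a b : scalar) (s t : rtree) :
  smul a (looped s) = smul b (looped t) ->
  (s = t /\ a = b) \/
  exists c, a = smul c (looped t) /\ b = smul c (looped s).
Proof.
rewrite -!sjux_looped => -[/attach_loop_fiber[/sjux_tree_inj[-> ->]|]].
  by left.
move=> [c [u [u' [/sjux_tree_inj[-> ->] /sjux_tree_inj[-> ->]]]]].
by right; exists c.
Qed.

Lemma divides_smul_looped (s t : rtree) (a : scalar) :
  divides s (smul a (looped t)) -> s = t \/ divides s a.
Proof.
case=> b /esym/smul_looped_eq[[-> _]|[c [_ ->]]]; first by left.
by right; exists c.
Qed.

Definition looped_prod (r : seq rtree) : scalar :=
  \big[smul/None]_(t <- r) looped t.

Lemma looped_prod_cons (t : rtree) (r : seq rtree) :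
  looped_prod (t :: r) = smul (looped t) (looped_prod r).
Proof. exact: big_cons. Qed.

Lemma looped_prod_cat (r r' : seq rtree) :
  looped_prod (r ++ r') = smul (looped_prod r) (looped_prod r').
Proof. exact: big_cat. Qed.

Lemma looped_prod_perm (r r' : seq rtree) :
  perm_eq r r' -> looped_prod r = looped_prod r'.
Proof. exact: perm_big. Qed.

Lemma divides_prod (s : rtree) (a : scalar) (r : seq rtree) :
  divides s (smul a (looped_prod r)) -> s \in r \/ divides s a.
Proof.
elim: r a => [|t r IHr] a; first by rewrite /looped_prod big_nil smulC; right.
rewrite looped_prod_cons smulA => /IHr[sr|/divides_smul_looped[->|]].
- by left; rewrite inE sr orbT.
- by left; rewrite inE eqxx.
- by right.
Qed.

(** Each looped tree has a self-loop, so that dividing by looped trees as long as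
    possible comes to an end. *)
Lemma factor_looped (a : scalar) :
  exists b (r : seq rtree), a = smul b (looped_prod r) /\
    forall t, ~ divides t b.
Proof.
have [n] := ubnP (snloops a); elim: n a => // n IHn a an.
have [[t [b ab]]|nd] := EM (exists t, divides t a); last first.
  exists a, [::]; rewrite /looped_prod big_nil smulC; split=> // t td.
  by apply: nd; exists t.
have [|c [r [bE cd]]] := IHn b.
  move: an; rewrite ab snloops_smul ltnS; apply: leq_trans.
  by rewrite -addn1 leq_add2l snloops_looped.
by exists c, (t :: r); rewrite looped_prod_cons (smulC (looped t)) smulA -bE.
Qed.

(** * Linear extensions and triangular kernels *)

(** Only the values of the divergence on basis vectors matter for the linear
    algebra, which is therefore done over arbitrary index types. *)
Section LinearExtension.

Variables (R : realType) (X Y : choiceType) (D : Y -> {malg R[X]}).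

Lemma coefU (K : choiceType) (x z : K) :
  (<< x >> : {malg R[K]})@_z = (x == z)%:R.
Proof. exact: mcoeffU. Qed.

Definition extend (f : {malg R[Y]}) : {malg R[X]} :=
  \sum_(y <- msupp f) f@_y *: D y.

Lemma extendEw (d : {fset Y}) (f : {malg R[Y]}) :
  (msupp f `<=` d)%fset -> extend f = \sum_(y <- d) f@_y *: D y.
Proof.
move=> fd; rewrite /extend; apply: big_fset_incl => // x _ /mcoeff_outdom ->.
by rewrite scale0r.
Qed.

Lemma extend_is_linear (c : R) (f g : {malg R[Y]}) :
  extend (c *: f + g) = c *: extend f + extend g.
Proof.
pose d := (msupp f `|` msupp g)%fset.
have fd : (msupp f `<=` d)%fset by exact: fsubsetUl.
have gd : (msupp g `<=` d)%fset by exact: fsubsetUr.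
have hd : (msupp (c *: f + g) `<=` d)%fset.
  apply: fsubset_trans (msuppD_le _ _) _; apply: fsetSU; exact: msuppZ_le.
rewrite (extendEw fd) (extendEw gd) (extendEw hd) scaler_sumr -big_split /=.
by apply: eq_bigr => x _; rewrite mcoeffD mcoeffZ scalerDl scalerA.
Qed.

Lemma extend0 : extend 0 = 0.
Proof. by rewrite /extend msupp0 big_seq_fset0. Qed.

Lemma extendZ (c : R) (f : {malg R[Y]}) : extend (c *: f) = c *: extend f.
Proof. by have := extend_is_linear c f 0; rewrite extend0 !addr0. Qed.

Lemma extendD (f g : {malg R[Y]}) : extend (f + g) = extend f + extend g.
Proof. by have := extend_is_linear 1 f g; rewrite !scale1r. Qed.

Lemma extendB (f g : {malg R[Y]}) : extend (f - g) = extend f - extend g.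
Proof. by rewrite -scaleN1r extendD extendZ scaleN1r. Qed.

Lemma extend_sum (I : Type) (r : seq I) (F : I -> {malg R[Y]}) :
  extend (\sum_(i <- r) F i) = \sum_(i <- r) extend (F i).
Proof. exact: (big_morph _ extendD extend0). Qed.

Lemma extendU (y : Y) : extend << y >> = D y.
Proof. by rewrite /extend msuppU oner_eq0 big_seq_fset1 mcoeffUU scale1r. Qed.

Lemma extend_sumU (I : Type) (r : seq I) (F : I -> Y) :
  extend (\sum_(i <- r) << F i >>) = \sum_(i <- r) D (F i).
Proof. by rewrite extend_sum; apply: eq_bigr => i _; rewrite extendU. Qed.

Lemma extend_half (x y : Y) :
  extend (2^-1 *: (<< x >> - << y >>)) = 2^-1 *: (D x - D y).
Proof. by rewrite extendZ extendB !extendU. Qed.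

Lemma extend_half_eq0 (f g : {malg R[Y]}) :
  extend f = extend g -> extend (2^-1 *: (f - g)) = 0.
Proof. by move=> fg; rewrite extendZ extendB fg subrr scaler0. Qed.

End LinearExtension.

Lemma seq_min (T : eqType) (r : rel T) (x : T) (s : seq T) :
  transitive r -> total r ->
  exists2 m, m \in x :: s & forall y, y \in x :: s -> r m y.
Proof.
move=> rT rt; have rr y : r y y by have := rt y y; rewrite orbb.
elim: s x => [|y s IHs] x.
  by exists x => [|y]; rewrite ?mem_head // inE => /eqP ->.
have [m ms mP] := IHs y; have [xm|mx] := orP (rt x m).
  exists x; rewrite ?mem_head // => z; rewrite in_cons => /predU1P[->//|/mP].
  exact: rT.
exists m; first by rewrite in_cons ms orbT.
by move=> z; rewrite in_cons => /predU1P[->//|/mP].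
Qed.

(** A kernel is computed from leading terms: D has leading term top for the degrees
    degX and degY, and top is injective on minimal elements; the vectors B i lie
    in the kernel and have leading terms (lead' i - lead i) / 2, and each element
    that is not minimal is lead i for some i such that lead' i is minimal. *)
Section Triangular.

Variables (R : realType) (X Y I : choiceType) (D : Y -> {malg R[X]}).
Variables (degX : X -> nat) (degY : Y -> nat) (top : Y -> X).
Variables (B : I -> {malg R[Y]}) (good : I -> Prop) (lead lead' : I -> Y).
Variable isMin : Y -> Prop.

Hypothesis deg_top : forall y, degX (top y) = (degY y).+1.
Hypothesis D_top : forall y z, degX z != degY y -> (D y)@_z = (top y == z)%:R.
Hypothesis B_lead : forall i z, (degY (lead i) <= degY z)%N ->
  (B i)@_z = 2^-1 * ((lead' i == z)%:R - (lead i == z)%:R).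
Hypothesis B_ker : forall i, extend D (B i) = 0.
Hypothesis min_or_lead : forall y, isMin y \/
  exists i, [/\ good i, y = lead i & isMin (lead' i)].
Hypothesis min_inj : forall y z, isMin y -> isMin z -> top y = top z -> y = z.
Hypothesis lead_inj : forall i j, good i -> good j -> lead i = lead j -> i = j.
Hypothesis lead_neq : forall i j, good i -> good j -> lead i <> lead' j.

Let isB (f : {malg R[Y]}) : Prop := exists i, good i /\ f = B i.

(** A combination of minimal elements in the kernel vanishes: at the top degree,
    nothing cancels the image of a term. *)
Lemma ker_min_eq0 (f : {malg R[Y]}) :
  extend D f = 0 -> (forall y, f@_y != 0 -> isMin y) -> f = 0.
Proof.
move=> Df0 fmin; case E : (msupp f : seq Y) => [|y0 s].
  apply/malgP => y; rewrite mcoeff0 mcoeff_outdom //.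
  by rewrite -[y \in _]/(y \in (msupp f : seq Y)) E.
pose r := [rel y z : Y | degY z <= degY y]%N.
have [||m ms mP] := @seq_min _ r y0 s.
- by move=> y x z /= yx zy; exact: leq_trans zy yx.
- by move=> x y /=; exact: leq_total.
rewrite -E in ms mP.
have fm : f@_m != 0 by rewrite mcoeff_neq0.
have := congr1 (mcoeff (top m)) Df0.
rewrite mcoeff0 /extend raddf_sum /= (bigD1_seq m) ?fset_uniq //= big_seq_cond.
rewrite big1 => [|y /andP[ys ym]]; rewrite mcoeffZ.
  rewrite D_top ?eqxx ?deg_top 1?eq_sym ?neq_ltn ?ltnSn //= mulr1 addr0.
  by move=> fm0; rewrite fm0 eqxx in fm.
rewrite D_top ?deg_top; last by rewrite neq_ltn ltnS [(degY y <= _)%N]mP ?orbT.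
case: eqP => [/min_inj E'|]; last by rewrite mulr0.
by rewrite E' ?eqxx // in ym; apply: fmin => //; rewrite mcoeff_neq0.
Qed.

(** Lists of coefficients and vectors are easier to concatenate than the data of
    [in_span]. *)
Definition combination (f : {malg R[Y]}) : Prop :=
  exists l : seq (R * {malg R[Y]}),
    (forall p, p \in l -> isB p.2) /\ f = \sum_(p <- l) p.1 *: p.2.

Lemma combination0 : combination 0.
Proof. by exists [::]; rewrite big_nil. Qed.

Lemma combinationD f g : combination f -> combination g -> combination (f + g).
Proof.
case=> l [lB ->] [l' [lB' ->]]; exists (l ++ l'); rewrite big_cat; split=> // p.
by rewrite mem_cat => /orP[/lB|/lB'].
Qed.

Lemma combinationZ c f : combination f -> combination (c *: f).
Proof.
case=> l [lB ->]; exists [seq (c * p.1, p.2) | p <- l]; split.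
  by move=> _ /mapP[p /lB pB ->].
by rewrite big_map scaler_sumr; apply: eq_bigr => p _; rewrite scalerA.
Qed.

Lemma combination_span f : combination f -> in_span isB f.
Proof.
case=> l [lB ->]; exists (undup (map snd l)).
exists (fun v => \sum_(p <- l | p.2 == v) p.1); split.
  by move=> v; rewrite mem_undup => /mapP[p /lB pB ->].
under [RHS]eq_bigr => v _ do rewrite scaler_suml big_mkcond.
rewrite exchange_big /= big_seq [RHS]big_seq; apply: eq_bigr => p pl.
have p2l : p.2 \in undup (map snd l) by rewrite mem_undup map_f.
rewrite (bigD1_seq _ p2l) ?undup_uniq //= eqxx big1 ?addr0 // => v.
by rewrite eq_sym => /negbTE ->.
Qed.

(** Being a combination of minimal elements up to the span of the vectors B i. *)
Definition reducible (f : {malg R[Y]}) : Prop :=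
  exists2 g, combination g & forall y, (f - g)@_y != 0 -> isMin y.

Lemma reducibleD f g : reducible f -> reducible g -> reducible (f + g).
Proof.
case=> f' cf fm [g' cg gm]; exists (f' + g'); first exact: combinationD.
move=> y; rewrite opprD addrACA mcoeffD.
have [->|/fm//] := eqVneq (f - f')@_y 0.
by rewrite add0r => /gm.
Qed.

Lemma reducibleZ c f : reducible f -> reducible (c *: f).
Proof.
case=> f' cf fm; exists (c *: f'); first exact: combinationZ.
move=> y; rewrite -scalerBr mcoeffZ mulf_eq0 negb_or => /andP[_]; exact: fm.
Qed.

Lemma reducible_msupp f :
  (forall y, y \in msupp f -> reducible << y >>) -> reducible f.
Proof.
move=> fr; rewrite [f]monalgE big_seq; elim/big_ind: _.
- exists 0; first exact: combination0.
  by move=> y; rewrite subrr mcoeff0 eqxx.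
- exact: reducibleD.
move=> y /fr; move/(reducibleZ f@_y); congr reducible; apply/malgP => z.
by rewrite mcoeffZ !mcoeffU mulrnAr mulr1.
Qed.

Lemma reducible_min y : isMin y -> reducible << y >>.
Proof.
move=> ym; exists 0; first exact: combination0.
move=> z; rewrite subr0 coefU; have [<- //|_] := eqVneq y z.
by rewrite eqxx.
Qed.

(** The basis element led by y exchanges y for a minimal element, up to terms
    of smaller degree. *)
Lemma reducibleU y : reducible << y >>.
Proof.
have [n] := ubnP (degY y); elim: n y => // n IHn y yn.
have [ym|[i [gi yE lm]]] := min_or_lead y.
  exact: reducible_min.
(* B i has coefficient - 1 / 2 at y. *)
have -> : << y >> = (<< y >> + 2 *: B i) + (- 2) *: B i :> {malg R[Y]}.
  by rewrite scaleNr addrK.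
apply: reducibleD; last first.
  apply: reducibleZ; exists (B i); last first.
    by move=> z; rewrite subrr mcoeff0 eqxx.
  exists [:: (1, B i)]; rewrite big_seq1 scale1r; split=> // p.
  by rewrite inE => /eqP -> /=; exists i.
apply: reducible_msupp => z.
have [zy _|yz] := ltnP (degY z) (degY y).
  by apply: IHn; apply: leq_trans zy _; rewrite -ltnS.
rewrite -mcoeff_neq0 mcoeffD mcoeffZ coefU B_lead -?yE // mulrA.
have -> : 2 * 2^-1 = 1 :> R by rewrite divff ?Num.Theory.pnatr_eq0.
rewrite mul1r addrCA subrr addr0.
have [<- _|_] := eqVneq (lead' i) z; last by rewrite eqxx.
exact: reducible_min.
Qed.

Lemma triangular_span f : extend D f = 0 -> in_span isB f.
Proof.
move=> Df0; have [g cg fgm] := @reducible_msupp f (fun y _ => reducibleU y).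
apply: combination_span.
have Dg0 : extend D g = 0.
  case: cg => l [lB ->]; rewrite extend_sum big_seq big1 // => p /lB[i [_ ->]].
  by rewrite extendZ B_ker scaler0.
suff /eqP : f - g = 0 by rewrite subr_eq0 => /eqP ->.
by apply: ker_min_eq0 => //; rewrite extendB Df0 Dg0 subrr.
Qed.

(** In a relation, the coefficient at the leading element of a term of maximal
    degree comes from this term only. *)
Lemma triangular_lin_indep : lin_indep isB.
Proof.
move=> s c us sB s0 v vs; apply/eqP; apply: contraT => cv0.
have [i0 _] := sB v vs.
have [|idx idxP] := @choice _ _
    (fun (w : {malg R[Y]}) i => w \in s -> good i /\ w = B i).
  move=> w; have [/sB[i iP]|ws] := boolP (w \in s); first by exists i.
  by exists i0.
pose r := [rel w w' | degY (lead (idx w')) <= degY (lead (idx w))]%N.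
have [||m ms mP] := @seq_min _ r v [seq w <- s | c w != 0].
- by move=> y x z /= yx zy; exact: leq_trans zy yx.
- by move=> x y /=; exact: leq_total.
have [ms' cm0] : m \in s /\ c m != 0.
  by move: ms; rewrite inE mem_filter => /predU1P[->//|/andP[]].
have [gm mE] := idxP m ms'.
have nl w : w \in s -> (lead' (idx w) == lead (idx m)) = false.
  by case/idxP=> gw _; apply/negP => /eqP/esym; exact: lead_neq.
have := congr1 (mcoeff (lead (idx m))) s0.
rewrite mcoeff0 raddf_sum /= (bigD1_seq m) //= big_seq_cond big1 ?addr0.
  rewrite mcoeffZ (congr1 (mcoeff _) mE) B_lead // eqxx nl // sub0r mulrN mulr1.
  move/eqP; rewrite mulf_eq0 (negbTE cm0) oppr_eq0 invr_eq0.
  by rewrite Num.Theory.pnatr_eq0.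
move=> w /andP[ws wm]; rewrite mcoeffZ.
have [->|cw0] := eqVneq (c w) 0; first by rewrite mul0r.
have [gw wE] := idxP w ws; rewrite (congr1 (mcoeff _) wE) B_lead; last first.
  by apply: mP; rewrite inE mem_filter cw0 ws orbT.
rewrite nl //; have [/lead_inj F|_] := eqVneq (lead (idx w)) (lead (idx m)).
  by case/eqP: wm; rewrite wE mE F.
by rewrite subrr !mulr0.
Qed.

Lemma triangular_basis : is_basis (fun f => extend D f = 0) isB.
Proof.
split; [|exact: triangular_lin_indep|exact: triangular_span].
by move=> _ [i [_ ->]].
Qed.

End Triangular.

(** * The divergence and its leading term *)

Lemma eq_double_sum (V : nmodType) (T T' : finType) (F : T -> T -> V)
    (G : T' -> T' -> V) (p : T -> T') :
  bijective p -> (forall u w, F u w = G (p w) (p u)) ->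
  \sum_u \sum_w F u w = \sum_u \sum_w G u w.
Proof.
move=> bp FG; have bp' : {on [pred _ | true], bijective p} by exact: onW_bij.
rewrite exchange_big /= [RHS](reindex p) //; apply: eq_bigr => u _.
by rewrite [RHS](reindex p) //; apply: eq_bigr => w _.
Qed.

Section Divergence.

Variable R : realType.

(** Of all the edges leaving the last root of x, only the self-loop raises the
    number of self-loops. *)
Lemma dH_forest_lead (n : nat) (x : forest n.+1) (z : forest n) :
  nloops z != nloops x -> (dH_forest R x)@_z = (loop x == z)%:R.
Proof.
move=> zx; have [r rP] := presents_rootP ord_max (presents_repr x).
rewrite /dH_forest (bigD1 r) //= mcoeffD coefU raddf_sum /=.
have -> : \pi_(forest n) (link (fun _ : nodes (repr x) => r)) = loop x.
  apply: (presents_inj _ (presents_loop (presents_repr x))).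
  apply: (presents_eqfun (presents_link _)) => v; rewrite /edge_link.
  have := rP v; case: (succ v) => [//|i].
  rewrite (inj_eq inr_inj); case: unliftP => // -> /=.
  by rewrite eqxx => /esym/eqP ->.
rewrite big1 ?addr0 // => u ur; rewrite coefU.
case: eqP => // uz; move: zx; rewrite -uz nloops_link ?reprK ?eqxx //.
by rewrite rP.
Qed.

Lemma dH_wedge2 (a : scalar) (t t' : rtree) :
  dH (wedge2 R a t t') = 2^-1 *:
    (dH_forest R (sjux a (jux (val t) (val t'))) -
     dH_forest R (sjux a (jux (val t') (val t)))).
Proof.
exact (extend_half (@dH_forest R 1) (sjux a (jux (val t) (val t')))
  (sjux a (jux (val t') (val t)))).
Qed.

Lemma dH_dH_forest (x : forest 2) :
  dH (dH_forest R x) =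
    \sum_(u : nodes (repr x)) \sum_(w : nodes (repr x))
      << \pi_(forest 0) (link (g := link (fun _ => u)) (fun _ => w)) >>.
Proof.
have E := extend_sumU (@dH_forest R 0) (index_enum (nodes (repr x)))
  (fun u => \pi_(forest 1) (link (fun _ => u))).
apply: (etrans E); apply: eq_bigr => u _.
exact: dH_forest_pi.
Qed.

(** Both linked roots choose their targets independently, so exchanging the two
    trees does not change the double divergence. *)
Lemma dH_dH_wedge2 (a : scalar) (t t' : rtree) : dH (dH (wedge2 R a t t')) = 0.
Proof.
rewrite dH_wedge2; set Z := sjux a _; set Z' := sjux a _.
apply: (@extend_half_eq0 R _ _ (@dH_forest R 0)).
have [sZ sZ'] := (presents_repr Z, presents_repr Z').
have [p [q [pK qK pE qE]]] := presents_morph (presents_swap sZ) sZ'.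
apply: (etrans (dH_dH_forest Z)); apply: (etrans _ (esym (dH_dH_forest Z'))).
apply: (eq_double_sum (p := p)) => [|u w]; first by exists q.
congr << _ >>; apply/forest_eqP/isoP; exists p; first by exists q.
have L (x : forest 2) (a1 a2 v : nodes (repr x)) :
    @succ _ (link (g := link (fun _ : nodes (repr x) => a1)) (fun _ => a2)) v =
    edge_link (edge_link (@succ _ (repr x)) (fun _ => a1)) (fun _ => a2) v.
  by rewrite /edge_link /succ /= ffunE /succ /= ffunE.
move=> v; apply: (etrans (L Z' _ _ _)).
apply: (etrans _ (f_equal (map_node p) (esym (L Z _ _ _)))).
rewrite /edge_link pE; case: (@succ _ (repr Z) v) => [//|i] /=.
have [->|->] : i = ord0 \/ i = ord_max.
  by case: i => -[|[|//]] i2; [left|right]; exact: val_inj.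
- have -> : rev_ord (ord0 : 'I_2) = ord_max by exact: val_inj.
  rewrite unlift_none; case: unliftP => [j _|/(congr1 val)//].
  by rewrite unlift_ord1.
have -> : rev_ord (ord_max : 'I_2) = ord0 by exact: val_inj.
rewrite unlift_none; case: unliftP => [j _|/(congr1 val)//].
by rewrite unlift_ord1.
Qed.

End Divergence.

(** A triple (a, t, t') stands for the wedge a t /\ t', in the divergence of which
    the terms with the most self-loops are [lead] and [lead']. *)
Definition lead (i : scalar * rtree * rtree) : forest 1 :=
  let: (a, t, t') := i in sjux (smul a (looped t)) (val t').

Definition lead' (i : scalar * rtree * rtree) : forest 1 :=
  let: (a, t, t') := i in lead (a, t', t).

(** The condition under which, in an aromatic tree, the tree at the root comes
    first among all the trees that could have been left unlooped. *)
Definition min_tree (le : rel rtree) (x : forest 1) : Prop :=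
  exists a t, x = sjux a (val t) /\ forall s, divides s a -> le t s.

Lemma nloops_swap (a : scalar) (t t' : forest 1) :
  nloops (sjux a (jux t t') : forest 2) = nloops (sjux a (jux t' t) : forest 2).
Proof.
have sx := presents_repr (sjux a (jux t t') : forest 2).
rewrite (presents_nloops sx) (presents_nloops (presents_swap sx)).
by apply: eq_card => v; rewrite !inE; case: (succ v).
Qed.

Lemma lead_loop (a : scalar) (t t' : rtree) :
  lead (a, t, t') = loop (sjux a (jux (val t') (val t))).
Proof. by rewrite loop_sjux_jux. Qed.

Lemma dH_wedge2_lead (R : realType) (a : scalar) (t t' : rtree) (z : forest 1) :
  (nloops (lead (a, t, t')) <= nloops z)%N ->
  (dH (wedge2 R a t t'))@_z =
    2^-1 * ((lead' (a, t, t') == z)%:R - (lead (a, t, t') == z)%:R).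
Proof.
rewrite /lead' !lead_loop nloops_loop => zl.
rewrite dH_wedge2 mcoeffZ mcoeffB !dH_forest_lead //.
  by rewrite neq_ltn zl orbT.
by rewrite nloops_swap neq_ltn zl orbT.
Qed.

(** * The pairs of trees indexing the basis *)

Lemma uniq_sub_perm (T : eqType) (r v : seq T) :
  uniq v -> {subset v <= r} -> exists r', perm_eq r (v ++ r').
Proof.
elim: v r => [|x v IHv] r /=; first by exists r.
case/andP=> xv uv vr; have xr : x \in r by apply: vr; rewrite mem_head.
have [|r' r'P] := IHv (rem x r) uv.
  move=> y yv; apply: rem_mem; last by apply: vr; rewrite inE yv orbT.
  by apply: contraNneq xv => <-.
by exists r'; rewrite (permPl (perm_to_rem xr)) perm_cons.
Qed.

Definition min_pair (le : rel rtree) (a : scalar) (t t' : rtree) : Prop :=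
  [/\ le t t', t != t' & forall s, divides s a -> le t s].

Section Order.

Variables (le : rel rtree) (le_order : total_order le).

Let le_anti : antisymmetric le. Proof. by case: le_order. Qed.
Let le_trans : transitive le. Proof. by case: le_order. Qed.
Let le_total : total le. Proof. by case: le_order. Qed.
Let le_refl : reflexive le.
Proof. by move=> t; have := le_total t t; rewrite orbb. Qed.

(** The trees t_1, ..., t_k are recovered from a minimal pair as the looped
    divisors of the scalar together with the two members of the pair, listed in
    increasing order: the first of them is t by minimality, and phi is what is
    left of the scalar after dividing it once by each of the other k - 2. *)
Lemma B_PsiP (R : realType) (v : Span R 1) :
  B_Psi le v <->
  exists a t t', min_pair le a t t' /\ v = dH (wedge2 R a t t').
Proof.
split=> [[k [phi [t [l [tP l0 phiP ->]]]]]|[a [t1 [t2 [[t12 nt12 t1P] ->]]]]].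
  have t0P i : i != ord0 -> le (t ord0) (t i) && (t ord0 != t i).
    by move=> i0; apply: tP; rewrite lt0n.
  have t0le i : le (t ord0) (t i).
    by have [->//|/t0P/andP[]] := eqVneq i ord0.
  eexists _, (t ord0), (t l); split; last by [].
  split=> [//||s]; first by have /andP[] := t0P _ l0.
  have -> : \big[smul/None]_(i | (i != ord0) && (i != l))
        Some (attach_loop (val (t i))) =
      looped_prod [seq t i | i <- index_enum _ & (i != ord0) && (i != l)].
    by rewrite /looped_prod big_map big_filter.
  by case/divides_prod=> [/mapP[i _ ->]|[psi /phiP[i ->]]].
have [a0 [r [aE a0P]]] := factor_looped a.
pose u := sort le (undup [:: t1, t2 & r]).
have uu : uniq u by rewrite sort_uniq undup_uniq.
have uE s : (s \in u) = [|| s == t1, s == t2 | s \in r].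
  by rewrite mem_sort mem_undup !inE.
have rdiv s : s \in r -> divides s a.
  move=> sr; exists (smul a0 (looped_prod (rem s r))).
  by rewrite aE (looped_prod_perm (perm_to_rem sr)) looped_prod_cons
             (smulC (looped s)) smulA.
have u1 s : s \in u -> le t1 s.
  by rewrite uE => /or3P[/eqP->|/eqP->|/rdiv/t1P].
have uS : sorted le u by exact: sort_sorted.
have t1u : t1 \in u by rewrite uE eqxx.
have t2u : t2 \in u by rewrite uE eqxx orbT.
have u0 : nth t1 u 0 = t1.
  case: u uS t1u u1 {uu uE t2u} => // x u xu t1u u1.
  apply: le_anti; rewrite /= u1 ?mem_head // andbT.
  move: t1u; rewrite inE => /predU1P[->//|t1u].
  by have /allP/(_ _ t1u) := order_path_min le_trans xu.
have i2 : (index t2 u < size u)%N by rewrite index_mem.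
have i20 : index t2 u != 0%N.
  by apply: contraNneq nt12 => i20; rewrite -(nth_index t1 t2u) i20 u0.
case Eu : (size u) i2 => [|[|k]] // i2; first by case: (index t2 u) i2 i20.
pose t (i : 'I_k.+2) := nth t1 u i.
have tE (i j : 'I_k.+2) : (t i == t j) = (i == j).
  by rewrite /t nth_uniq ?Eu.
pose l : 'I_k.+2 := Ordinal i2.
have tl : t l = t2 by rewrite /t /= nth_index.
have t0 : t ord0 = t1 by rewrite /t.
have tu s : s \in u -> exists i, s = t i.
  move=> su; have is_ : (index s u < k.+2)%N by rewrite -Eu index_mem.
  by exists (Ordinal is_); rewrite /t /= nth_index.
pose mid := [seq t i | i <- index_enum _ & (i != ord0) && (i != l)].
have [||r' r'P] := @uniq_sub_perm _ r mid.
- rewrite map_inj_uniq ?filter_uniq ?index_enum_uniq // => i j /eqP.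
  by rewrite tE => /eqP.
- move=> _ /mapP[i + ->]; rewrite mem_filter => /andP[/andP[i0 il] _].
  have : t i \in u by rewrite mem_nth ?Eu.
  have /negbTE nt1 : t i != t1 by rewrite -t0 tE.
  have /negbTE nt2 : t i != t2 by rewrite -tl tE.
  by rewrite uE nt1 nt2.
exists k, (smul a0 (looped_prod r')), t, l; split.
- move=> i j ij; rewrite tE neq_ltn ij andbT.
  by apply: (sorted_leq_nth le_trans le_refl t1 uS); rewrite ?inE ?Eu // ltnW.
- by [].
- move=> s psi sP; apply: tu; rewrite uE.
  have /divides_prod[sr'|/a0P//] : divides s (smul a0 (looped_prod r')).
    exists psi; exact sP.
  by apply/or3P/Or33; rewrite (perm_mem r'P) mem_cat; apply/orP; right.
rewrite t0 tl; apply: (f_equal (fun c => dH (wedge2 R c t1 t2))).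
have -> : \big[smul/None]_(i | (i != ord0) && (i != l))
    Some (attach_loop (val (t i))) = looped_prod mid.
  by rewrite /looped_prod big_map big_filter.
by rewrite aE (looped_prod_perm r'P) looped_prod_cat -smulA
           (smulC (looped_prod r')).
Qed.

(** If the tree t at the root is not minimal, exchange it with the smallest
    looped divisor m of the scalar: the pair (m, t) is minimal, and so is the aromatic
    tree obtained by the exchange. *)
Lemma min_tree_or_lead (x : forest 1) :
  min_tree le x \/
  exists i, [/\ min_pair le i.1.1 i.1.2 i.2, x = lead i & min_tree le (lead' i)].
Proof.
have [a [t ->]] := aromatic_tree_split x.
have [b [r [aE bP]]] := factor_looped a.
have [m mr mP] := seq_min t r le_trans le_total.
have amin s : divides s a -> le m s.
  by rewrite aE => /divides_prod[sr|/bP//]; apply: mP; rewrite in_cons sr orbT.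
have [mt|mt] := eqVneq m t.
  by left; exists a, t; split=> // s /amin; rewrite mt.
move: mr; rewrite in_cons (negbTE mt) /= => mr.
have aE' : a = smul (smul b (looped_prod (rem m r))) (looped m).
  by rewrite aE (looped_prod_perm (perm_to_rem mr)) looped_prod_cons
             (smulC (looped m)) smulA.
have cdiv s : divides s (smul b (looped_prod (rem m r))) -> divides s a.
  case=> c cE; exists (smul c (looped m)).
  by rewrite {1}aE' cE -!smulA (smulC (looped s)).
have lmt : le m t by apply: mP; rewrite mem_head.
right; exists (smul b (looped_prod (rem m r)), m, t); split.
- by split=> // s /cdiv/amin.
- by rewrite /= -aE'.
exists (smul (smul b (looped_prod (rem m r))) (looped t)), m; split=> // s.
by case/divides_smul_looped=> [->//|/cdiv/amin].
Qed.

(** Two elements of a fibre have the shapes a phi(t') t and a phi(t) t', so if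
    both are minimal then each of t and t' precedes the other. *)
Lemma min_tree_inj (x y : forest 1) :
  min_tree le x -> min_tree le y -> attach_loop x = attach_loop y -> x = y.
Proof.
move=> [a [t [xE tP]]] [b [u [yE uP]]].
case/attach_loop_fiber=> [//|[c [t1 [u1 [xE' yE']]]]].
move: xE yE; rewrite {1}xE' {1}yE'.
move=> /sjux_tree_inj[aE t1E] /sjux_tree_inj[bE u1E].
have tu : t1 = u1.
  apply: le_anti; rewrite t1E u1E tP ?uP //.
    by exists c; rewrite -bE t1E.
  by exists c; rewrite -aE u1E.
by rewrite xE' yE' tu.
Qed.

(** Distinct pairs with the same leading element would have exchanged first
    members, each of which would divide the other scalar. *)
Lemma lead_inj (i j : scalar * rtree * rtree) :
  min_pair le i.1.1 i.1.2 i.2 -> min_pair le j.1.1 j.1.2 j.2 ->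
  lead i = lead j -> i = j.
Proof.
case: i j => -[a t] t' [[b u] u'] /= [_ _ tP] [_ _ uP] /sjux_tree_inj[E ->].
case/smul_looped_eq: E => [[-> ->] //|[c [aE bE]]].
have tu : t = u.
  by apply: le_anti; rewrite tP ?uP //; [exists c | exists c].
by rewrite aE bE tu.
Qed.

(** The second member of the pair i would be the first member of j, hence would
    come strictly after the first member of i; but the latter is the second
    member of j or a looped divisor of the scalar of j, which the first member of
    j precedes. *)
Lemma lead_neq (i j : scalar * rtree * rtree) :
  min_pair le i.1.1 i.1.2 i.2 -> min_pair le j.1.1 j.1.2 j.2 ->
  lead i <> lead' j.
Proof.
case: i j => -[a t] t' [[b u] u'] /= [tt' ntt' tP] [uu' nuu' uP].
case/sjux_tree_inj=> E t'u; subst t'.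
suff ut : le u t by case/eqP: ntt'; apply: le_anti; rewrite tt' ut.
case/smul_looped_eq: E => [[-> _] //|[c [_ bE]]].
by apply: uP; exists c.
Qed.

End Order.

Theorem theorem4p7 (R : realType) (le : rel rtree) (le_order : total_order le) :
  is_basis (@Psi R) (@B_Psi R le).
Proof.
pose B (i : scalar * rtree * rtree) := dH (wedge2 R i.1.1 i.1.2 i.2).
have BE v : B_Psi le v <-> exists i, min_pair le i.1.1 i.1.2 i.2 /\ v = B i.
  rewrite (B_PsiP le_order); split=> [[a [t [t' P]]]|[[[a t] t'] P]].
    by exists (a, t, t').
  by exists a, t, t'.
have [kerB indep span] := triangular_basis (D := @dH_forest R 0)
  (top := @attach_loop) (B := B) (isMin := min_tree le)
  (@nloops_loop 0) (@dH_forest_lead R 0)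
  (fun i z => match i return (nloops (lead i) <= nloops z)%N ->
     (B i)@_z = 2^-1 * ((lead' i == z)%:R - (lead i == z)%:R) with
     (a, t, t') => @dH_wedge2_lead R a t t' z end)
  (fun i => dH_dH_wedge2 R i.1.1 i.1.2 i.2)
  (min_tree_or_lead le_order) (@min_tree_inj le le_order)
  (@lead_inj le le_order) (@lead_neq le le_order).
split.
- by move=> v /BE/kerB.
- by move=> s c us sB; apply: indep => // v /sB/BE.
move=> v /span[s [c [sB vE]]]; exists s, c; split=> // w /sB.
by move/BE.
Qed.
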